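(* Let $\ell \ge 2$. If $K$ is a difference set of $\mathbb{F}_q$ and $q - k$ is a perfect square, then either $\ell$ is divisible by $4$, or $\ell=a^2+b^2$ for some odd integers $a$ and $b$.
   Context: Let $q$ be a power of an odd prime, $\ell$ a divisor of $q-1$, $K$ the subgroup of $\mathbb{F}_q^*$ consisting of all $\ell$-th powers of nonzero elements, and $k=|K|=\frac{q-1}{\ell}$. $K$ is a difference set of $\mathbb{F}_q$ if there is a positive integer $\lambda$ such that every nonzero element of $\mathbb{F}_q$ can be written as $x-y$ with $(x,y)\in K\times K$ in exactly $\lambda$ ways. *)

(* Defs.v *)
From HB Require Import structures.
From mathcomp Require Import all_boot all_order all_algebra.

Set Implicit Arguments.
Unset Strict Implicit.
Unset Printing Implicit Defensive.

Import GRing.Theory.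
Local Open Scope ring_scope.

Definition lth_powers (F : finFieldType) (l : nat) : {set F} :=
  [set x ^+ l | x in [set y : F | y != 0]].

Definition difference_set (V : finZmodType) (D : {set V}) : Prop :=
  exists2 lambda : nat, (0 < lambda)%N &
    forall z : V, z != 0 ->
      #|[set xy in setX D D | xy.1 - xy.2 == z]| = lambda.

Definition perfect_square (n : nat) : Prop := exists s : nat, n = (s ^ 2)%N.

(* Main.v *)
Require Import Defs.
From HB Require Import structures.
From mathcomp Require Import all_boot all_order all_algebra all_field.
From mathcomp Require Import zify ring.

(* Counting gives [k = lambda * l + 1], so that [q - k = l * n] with
   [n = 1 + lambda * (l - 1)], and a parity argument shows that [l] is even.
   Suppose [l = 2] modulo 4; then [q = 3] modulo 4.  By the two squares theorem
   it is enough that no prime [r = 3] modulo 4 divides [l] to an odd power.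
   Such an [r] divides [n] too, as [l * n] is a square, whence
   [q = k = lambda = 1] modulo [r].  By quadratic reciprocity, proved here for
   [F] with a Gauss sum, [r] is a nonsquare of [F], hence a power [N] of [r]
   equals -1 in [F].  Working in the group ring of [(F, +)] over ['F_r], the
   element [E := sum of K - sum of F] satisfies [E * E^* = 0], where [^*] is
   induced by [x |-> - x], and [E ^ N = E^*], [E^* ^ N = E] by Frobenius.  So
   [E] is nilpotent and equal to [E ^ (N * N)], that is, [E = 0]: but [K] is
   not all of [F]. *)

Set Implicit Arguments.
Unset Strict Implicit.
Unset Printing Implicit Defensive.
Import Order.TTheory GRing.Theory Num.Theory.
Local Open Scope ring_scope.

(** * Sums of two squares *)

Definition sum_two_squares (n : nat) : Prop :=
  exists a b : int, n%:Z = a ^+ 2 + b ^+ 2.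

(** Multiplicativity of the norm of Gaussian integers. *)
Lemma sum_two_squaresM m n :
  sum_two_squares m -> sum_two_squares n -> sum_two_squares (m * n).
Proof.
move=> [a [b em]] [c [d en]]; exists (a * c + b * d), (a * d - b * c).
by rewrite PoszM em en; ring.
Qed.

Lemma sqrtn_floor n : exists s, (s ^ 2 <= n < s.+1 ^ 2)%N.
Proof.
elim: n => [|n [s IH]]; first by exists 0%N.
case: (leqP (s.+1 ^ 2) n.+1) => h; first by exists s.+1; nia.
by exists s; nia.
Qed.

(** With [p.-1 = h * 2 * 2], the polynomial ['X^(h * 2) - 1] has too few roots to vanish at every
    unit; a unit [x] that is not a root satisfies [x ^+ (h * 2) = -1]. *)
Lemma sqrt_m1_Fp p : prime p -> (p %% 4 = 1)%N -> exists x : 'F_p, x ^+ 2 = -1.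
Proof.
move=> p_pr p1.
have p_gt1 := prime_gt1 p_pr.
set h := (p.-1 %/ 4)%N.
have ph : (p.-1 = h * 2 * 2)%N by rewrite /h; lia.
have h_gt0 : (0 < h)%N by rewrite /h; lia.
have: ~~ all (root ('X^(h * 2) - 1 : {poly 'F_p})) (enum (predC1 (0%R : 'F_p))).
  apply/negP => /max_poly_roots.
  rewrite size_XnsubC ?muln_gt0 ?h_gt0 // enum_uniq -cardE => H.
  have: (#|predC1 (0%R : 'F_p)| < (h * 2).+1)%N.
    by apply: H; rewrite // -size_poly_eq0 size_XnsubC ?muln_gt0 ?h_gt0.
  have -> : #|predC1 (0%R : 'F_p)| = p.-1.
    by rewrite cardC1 card_Fp.
  by rewrite ph; lia.
case/allPn => x; rewrite mem_enum inE => x0 xh; exists (x ^+ h).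
rewrite -exprM; apply/eqP; rewrite -addr_eq0.
have: (x ^+ (h * 2) - 1) * (x ^+ (h * 2) + 1) == 0.
  rewrite -subr_sqr expr1n -exprM -ph subr_eq0.
  apply/eqP/(mulfI x0); rewrite mulr1 -exprS prednK ?prime_gt0 //.
  by have := expf_card x; rewrite card_Fp.
rewrite mulf_eq0 => /orP[] // e; case/negP: xh.
by rewrite /root !hornerE.
Qed.

(* Thue's pigeonhole argument: with [x ^+ 2 = -1], two of the more than [p]
   combinations [u + x v], [0 <= u, v <= sqrt p], coincide modulo [p]. *)
Lemma prime_sum_two_squares p :
  prime p -> (p %% 4 = 1)%N -> sum_two_squares p.
Proof.
move=> p_pr p1; have [x x2] := sqrt_m1_Fp p_pr p1.
have [s /andP[s_le s_gt]] := sqrtn_floor p.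
(* Strictness gives [a ^+ 2 + b ^+ 2 < 2 * p] below; being a positive multiple of [p], this sum is
   then [p] itself. *)
have s_lt : (s ^ 2 < p)%N.
  rewrite ltn_neqAle s_le andbT; apply/eqP => e.
  have sp : (s %| p)%N by rewrite -e expnS dvdn_mulr.
  have p2 := prime_gt1 p_pr.
  move: sp; case/primeP: p_pr => _ H /H /orP[] /eqP es; rewrite es in e; nia.
pose f (uv : 'I_s.+1 * 'I_s.+1) : 'F_p := (uv.1 : nat)%:R + x * (uv.2 : nat)%:R.
have /injectivePn[[u v] [[u' v'] neq]] : ~~ injectiveb f.
  apply/negP => /injectiveP /leq_card.
  by rewrite card_prod !card_ord Fp_cast // leqNgt mulnn s_gt.
rewrite /f /= => ef.
pose a : int := (u : nat)%:Z - (u' : nat)%:Z.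
pose b : int := (v : nat)%:Z - (v' : nat)%:Z.
exists a, b.
have ea : a%:~R = - x * b%:~R :> 'F_p.
  by rewrite /a /b !intrB -!pmulrn; apply/eqP; rewrite -subr_eq0; apply/eqP;
    transitivity (((u : nat)%:R + x * (v : nat)%:R)
      - ((u' : nat)%:R + x * (v' : nat)%:R) : 'F_p); [ring | rewrite ef subrr].
have : (a ^+ 2 + b ^+ 2)%:~R = 0 :> 'F_p.
  by rewrite intrD !rmorphXn /= ea exprMn sqrrN x2; ring.
move/eqP; rewrite -(dvdz_pcharf (pchar_Fp p_pr)) => /dvdzP[c ec].
have neq0 : (a != 0) || (b != 0).
  apply: contraNT neq; rewrite negb_or !negbK !subr_eq0 => /andP[/eqP[eu] /eqP[ev]].
  by apply/eqP; congr pair; apply: val_inj.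
have := ltn_ord u; have := ltn_ord u'; have := ltn_ord v; have := ltn_ord v'.
move=> lv' lv lu' lu.
have la : a ^+ 2 <= (s ^ 2)%N%:Z by rewrite /a; nia.
have lb : b ^+ 2 <= (s ^ 2)%N%:Z by rewrite /b; nia.
have sgt0 : 0 < a ^+ 2 + b ^+ 2.
  by case/orP: neq0 => H; [apply: ltr_wpDr | apply: ltr_wpDl];
    rewrite ?sqr_ge0 // exprn_even_gt0.
rewrite ec; suff -> : c = 1 by rewrite mul1r.
rewrite ec in sgt0.
have : c * p%:Z < 2 * p%:Z by rewrite -ec; lia.
nia.
Qed.

Lemma sum_two_squaresP n : (0 < n)%N ->
  (forall r, prime r -> (r %% 4 = 3)%N -> ~~ odd (logn r n)) -> sum_two_squares n.
Proof.
elim/ltn_ind: n => n IH n_gt0 hr.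
case: (leqP n 1) => n1.
  by exists 1, 0; rewrite (_ : n = 1%N) //; lia.
have := pdiv_prime n1; have := pdiv_dvd n; set r := pdiv n => r_dvd r_pr.
have r_gt1 := prime_gt1 r_pr.
(* [t] will be [r], or [r ^ 2] when [r] is 3 modulo 4. The cofactor [c] inherits the parity
   hypothesis since the relevant exponents in [t] are even. *)
have step t : sum_two_squares t -> (1 < t)%N -> (t %| n)%N ->
  (forall r', prime r' -> (r' %% 4 = 3)%N -> ~~ odd (logn r' t)) ->
  sum_two_squares n.
  move=> st t1 /dvdnP[c ec] ht.
  have c_gt0 : (0 < c)%N by nia.
  rewrite ec; apply: sum_two_squaresM => //; apply: IH => //; first by nia.
  move=> r' r'_pr r'3; move: (hr r' r'_pr r'3) (ht r' r'_pr r'3).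
  by rewrite ec lognM ?oddD; [case: odd; case: odd | lia | lia].
have [r3|r3] := eqVneq (r %% 4)%N 3%N; last first.
  apply: (step r) => // [|r' r'_pr r'3].
    have [->|r2] := eqVneq r 2%N; first by exists 1, 1.
    apply: prime_sum_two_squares => //.
    have : odd r by case: (even_prime r_pr) => // e; rewrite e in r2.
    lia.
  rewrite logn_prime //; case: eqVneq => // e.
  by rewrite -e r'3 in r3.
apply: (step (r ^ 2)%N) => [|||r' r'_pr r'3].
- by exists r%:Z, 0; rewrite expr0n addr0 -mulnn PoszM expr2.
- by nia.
- rewrite pfactor_dvdn //.
  have : (0 < logn r n)%N by rewrite logn_gt0 mem_primes r_pr n_gt0.
  by have := hr r r_pr r3; case: (logn r n) => [|[]].
- by rewrite lognX mul2n odd_double.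
Qed.

(** * Group rings and difference sets *)

(** A separate name for the type of functions, so that its product can be convolution instead of the
    pointwise one. *)
Definition gring (R : comNzRingType) (V : finZmodType) : Type := {ffun V -> R}.

Section GroupRing.
Variables (R : comNzRingType) (V : finZmodType).
Local Notation RV := (gring R V).
Implicit Types (f g : RV) (x y z : V) (A B : {set V}).

HB.instance Definition _ := GRing.Zmodule.copy RV {ffun V -> R}.

Definition gring_base x : RV := [ffun z => (z == x)%:R].
Definition gring_mul f g : RV := [ffun z => \sum_x f x * g (z - x)].

Lemma gring_mulA : associative gring_mul.
Proof.
move=> f g h; apply/ffunP => z; rewrite !ffunE.
under eq_bigr do rewrite ffunE big_distrr /=.
under [RHS]eq_bigr do rewrite ffunE big_distrl /=.
rewrite [RHS]exchange_big /=; apply: eq_bigr => x _.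
rewrite [RHS](reindex_inj (addrI x)) /=; apply: eq_bigr => y _.
by rewrite [x + y]addrC addrK mulrA opprD addrA addrAC.
Qed.

Lemma gring_mulC : commutative gring_mul.
Proof.
move=> f g; apply/ffunP => z; rewrite !ffunE.
rewrite [RHS](reindex_inj (subrI z)) /=; apply: eq_bigr => x _.
by rewrite subKr mulrC.
Qed.

Lemma gring_mul1 : left_id (gring_base 0) gring_mul.
Proof.
move=> f; apply/ffunP => z; rewrite !ffunE (bigD1 0) //= big1 ?addr0.
  by rewrite ffunE eqxx mul1r subr0.
by move=> x /negPf x0; rewrite ffunE x0 mul0r.
Qed.

Lemma gring_mulDl : left_distributive gring_mul +%R.
Proof.
move=> f g h; apply/ffunP => z; rewrite !ffunE -big_split /=.
by apply: eq_bigr => x _; rewrite ffunE mulrDl.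
Qed.

Lemma gring_one_neq0 : gring_base 0 != 0.
Proof.
by apply/eqP => /ffunP/(_ 0)/eqP; rewrite !ffunE eqxx oner_eq0.
Qed.

HB.instance Definition _ := GRing.Zmodule_isComNzRing.Build RV
  gring_mulA gring_mulC gring_mul1 gring_mulDl gring_one_neq0.

Lemma gring1E z : (1 : RV) z = (z == 0)%:R.
Proof. by rewrite ffunE. Qed.

Lemma gringBE f g z : (f - g) z = f z - g z.
Proof. by rewrite ffunE [(- g) z]ffunE. Qed.

Lemma gringDE f g z : (f + g) z = f z + g z.
Proof. by rewrite ffunE. Qed.

Lemma gringMnE f n z : (f *+ n) z = f z *+ n.
Proof. by elim: n => [|n IH]; rewrite ?mulr0n ?ffunE // !mulrS gringDE IH. Qed.

Lemma gring_sumE I (s : seq I) (P : pred I) (f : I -> RV) z :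
  (\sum_(i <- s | P i) f i) z = \sum_(i <- s | P i) f i z.
Proof. by elim/big_rec2: _ => [|i a b _ <-]; rewrite ?ffunE. Qed.

Lemma gring_baseM x y : gring_base x * gring_base y = gring_base (x + y).
Proof.
apply/ffunP => z; rewrite !ffunE (bigD1 x) //= big1 ?addr0.
  by rewrite !ffunE eqxx mul1r subr_eq [y + x]addrC.
by move=> w /negPf wx; rewrite ffunE wx mul0r.
Qed.

Lemma gring_baseX x n : gring_base x ^+ n = gring_base (x *+ n).
Proof.
by elim: n => [|n IH]; rewrite ?expr0 ?mulr0n // exprS IH gring_baseM mulrS.
Qed.

Definition gring_set A : RV := \sum_(x in A) gring_base x.

Lemma gring_setE A z : gring_set A z = (z \in A)%:R.
Proof.
rewrite gring_sumE; under eq_bigr do rewrite ffunE.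
case: (boolP (z \in A)) => zA.
  rewrite (bigD1 z) //= eqxx big1 ?addr0 // => x /andP[_].
  by rewrite eq_sym => /negPf->.
by apply: big1 => x xA; case: eqP => // e; rewrite e xA in zA.
Qed.

Definition diff_pairs A z : {set V * V} :=
  [set xy in setX A A | xy.1 - xy.2 == z].

Lemma gring_set_diffE A z :
  (gring_set A * gring_set [set - x | x in A]) z = #|diff_pairs A z|%:R.
Proof.
rewrite /gring_set (big_imset _ (in2W oppr_inj)) /= big_distrlr /= gring_sumE.
under eq_bigr do rewrite gring_sumE.
rewrite pair_big /= -sum1_card natr_sum big_mkcond /= [RHS]big_mkcond /=.
apply: eq_bigr => -[x y] _; rewrite !inE /= gring_baseM ffunE eq_sym.
by case: (x \in A); case: (y \in A); case: eqP.
Qed.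

Lemma gring_set_mulT A :
  gring_set A * gring_set setT = gring_set setT *+ #|A|.
Proof.
rewrite {1}/gring_set mulr_suml -sumr_const; apply: eq_bigr => x _.
rewrite /gring_set mulr_sumr [RHS](reindex_inj (addrI x)) /=.
by apply: eq_big => [y|y _]; rewrite ?inE // gring_baseM.
Qed.

Lemma card_diff_pairs0 A : #|diff_pairs A 0| = #|A|.
Proof.
rewrite -(card_imset (mem A) (_ : injective (fun x : V => (x, x)))); last by move=> x y [].
apply: eq_card => -[x y]; rewrite !inE /= subr_eq0.
apply/andP/imsetP => [[/andP[xA _] /eqP <-]|[w wA [-> ->]]]; first by exists x.
by rewrite wA eqxx.
Qed.

Lemma sum_card_diff_pairs A : (\sum_z #|diff_pairs A z| = #|A| ^ 2)%N.
Proof.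
rewrite -mulnn -cardsX -sum1_card.
rewrite (partition_big (fun xy : V * V => xy.1 - xy.2) predT) //=.
apply: eq_bigr => z _; rewrite -sum1_card; apply: eq_bigl => xy.
by rewrite inE.
Qed.

Section ConstantDifferences.
Variables (A : {set V}) (lambda : nat).
Hypothesis A_diff : forall z, z != 0 -> #|diff_pairs A z| = lambda.

(** Sort the pairs of elements of [A] by their difference: the difference 0 occurs [#|A|] times. *)
Lemma diff_set_count : (#|A| ^ 2 = #|A| + lambda * #|V|.-1)%N.
Proof.
rewrite -sum_card_diff_pairs (bigD1 0) //= card_diff_pairs0; congr addn.
under eq_bigr => z z0 do rewrite A_diff //.
by rewrite sum_nat_const mulnC cardC1.
Qed.

Lemma gring_diff_set : gring_set A * gring_set [set - x | x in A] =
  1 *+ #|A| + (gring_set setT - 1) *+ lambda.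
Proof.
apply/ffunP => z; rewrite gring_set_diffE gringDE !gringMnE gringBE.
rewrite gring_setE gring1E inE; have [->|z0] := eqVneq z 0.
  by rewrite card_diff_pairs0 subrr mul0rn addr0.
by rewrite A_diff // mul0rn subr0 add0r.
Qed.

End ConstantDifferences.

Lemma gring_pchar p : p \in [pchar R] -> p \in [pchar RV].
Proof.
move=> pR; rewrite inE (pcharf_prime pR); apply/eqP/ffunP => z.
by rewrite gringMnE gring1E -mulrnA mulnC mulrnA (pcharf0 pR) ?mul0rn ?ffunE.
Qed.

(** Frobenius is additive and maps the basis element at [x] to the one at [x *+ p]. Injectivity
    prevents terms from merging, so the image is again the sum of a set. *)
Lemma gring_set_Frobenius p j A :
    p \in [pchar R] -> injective (fun x : V => x *+ p ^ j) ->
  gring_set A ^+ (p ^ j) = gring_set [set x *+ p ^ j | x in A].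
Proof.
move=> /gring_pchar pRV inj.
rewrite /gring_set (big_imset _ (in2W inj)) /= {inj}.
elim: j => [|j IH]; first by rewrite expr1.
rewrite expnSr exprM IH -(pFrobenius_autE pRV) rmorph_sum /=.
by apply: eq_bigr => x _; rewrite pFrobenius_autE gring_baseX mulrnA.
Qed.

Lemma card_opp_set A : #|[set - x | x in A]| = #|A|.
Proof. exact: card_imset oppr_inj. Qed.

Lemma mem_opp_set A z : (z \in [set - x | x in A]) = (- z \in A).
Proof.
by apply/imsetP/idP => [[x xA ->]|zA]; [rewrite opprK|exists (- z); rewrite ?opprK].
Qed.

End GroupRing.

Arguments gring_set R {V} A.

(* In characteristic 2 the square of [gring_set A] is its image under
   doubling, so a symmetric difference set would have [lambda = 1] modulo 2 at
   [u *+ 2] and [lambda = 0] modulo 2 at [w *+ 2]. *)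
Lemma diff_set_not_symmetric (V : finZmodType) (A : {set V}) (lambda : nat)
    (u w : V) :
    injective (fun x : V => x *+ 2) ->
    (forall z, z != 0 -> #|diff_pairs A z| = lambda) ->
    u \in A -> u != 0 -> w \notin A -> w != 0 ->
  [set - x | x in A] != A.
Proof.
move=> inj A_diff uA u0 wA w0; apply/eqP => A_sym.
have F2 : 2%N \in [pchar 'F_2] by apply: pchar_Fp.
have := gring_diff_set 'F_2 A_diff.
have sq := @gring_set_Frobenius 'F_2 V 2 1 A F2 inj.
rewrite A_sym -expr2 sq => /ffunP coef.
have coefE z : z != 0 -> (z \in A)%:R = lambda%:R :> 'F_2.
  move=> z0; have := coef (z *+ 2).
  have z2 : z *+ 2 != 0 by rewrite -(mul0rn V 2) (inj_eq inj).
  rewrite gringDE !gringMnE gringBE !gring_setE gring1E (negPf z2) inE.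
  by rewrite (mem_imset _ _ inj) mul0rn add0r subr0.
have := coefE u u0; rewrite -(coefE w w0) uA (negPf wA) => /eqP.
by rewrite oner_eq0.
Qed.

(** * Powers in a finite field *)

Section FiniteField.
Variable F : finFieldType.
Implicit Types (x y z : F).

(** Translation by 1 permutes [F], so it fixes the sum of all elements while adding [#|F|%:R] to
    it. *)
Lemma natf_card : #|F|%:R = 0 :> F.
Proof.
apply: (@addrI _ (\sum_(x : F) x)); rewrite addr0.
rewrite [RHS](reindex_inj (addIr 1)) /= big_split /=.
by rewrite sumr_const.
Qed.

Lemma card_1mod r : (r %| #|F|.-1)%N -> (#|F| = 1 %[mod r])%N.
Proof.
have F_gt0 : (0 < #|F|)%N by apply/card_gt0P; exists 0.
by move=> r_dvd; rewrite -(prednK F_gt0) -addn1 -modnDml (eqP r_dvd).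
Qed.

Lemma natf_dvd_card_neq0 d : (d %| #|F|.-1)%N -> d%:R != 0 :> F.
Proof.
case/dvdnP => c e; apply/eqP => d0; have := natf_card.
have F_gt0 : (0 < #|F|)%N by apply/card_gt0P; exists 0.
rewrite -(prednK F_gt0) mulrSr e natrM d0 mulr0 add0r => /eqP.
by rewrite oner_eq0.
Qed.

Lemma expf_card_pred x : x != 0 -> x ^+ #|F|.-1 = 1.
Proof.
move=> x0; apply/(mulfI x0); rewrite mulr1 -exprS prednK ?expf_card //.
by apply/card_gt0P; exists 0.
Qed.

Lemma card_expf_eq_le n x : (0 < n)%N -> (#|[set y : F | y ^+ n == x]| <= n)%N.
Proof.
move=> n_gt0; rewrite cardE -ltnS -(size_XnsubC x n_gt0).
apply: max_poly_roots; rewrite ?enum_uniq -?size_poly_eq0 ?size_XnsubC //.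
by apply/allP => y; rewrite mem_enum inE /root !hornerE subr_eq0.
Qed.

Lemma card_nonzero : #|[set y : F | y != 0]| = #|F|.-1.
Proof. by rewrite -(cardC1 (0 : F)); apply: eq_card => y; rewrite inE. Qed.

Lemma lth_powersM l x y :
  x \in lth_powers F l -> y \in lth_powers F l -> x * y \in lth_powers F l.
Proof.
move=> /imsetP[a + ->] /imsetP[b + ->]; rewrite !inE -exprMn => a0 b0.
by apply: imset_f; rewrite inE mulf_neq0.
Qed.

Lemma lth_powersV l x : x \in lth_powers F l -> x^-1 \in lth_powers F l.
Proof.
move=> /imsetP[a + ->]; rewrite !inE -exprVn => a0.
by apply: imset_f; rewrite inE invr_eq0.
Qed.

Lemma lth_powers1 l : 1 \in lth_powers F l.
Proof. by rewrite -(expr1n _ l); apply: imset_f; rewrite inE oner_eq0. Qed.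

Lemma lth_powers0 l : 0 \notin lth_powers F l.
Proof.
apply/imsetP => -[a]; rewrite inE => a0 /esym/eqP.
by rewrite expf_eq0 (negPf a0) andbF.
Qed.

Section PowersOfDivisor.
Variable l : nat.
Hypotheses (l_gt0 : (0 < l)%N) (l_dvd : (l %| #|F|.-1)%N).
Local Notation K := (lth_powers F l).
Local Notation k := (#|F|.-1 %/ l)%N.

Let card_gt1 : (0 < #|F|.-1)%N.
Proof. by rewrite -card_nonzero; apply/card_gt0P; exists 1; rewrite inE oner_eq0. Qed.

Let k_gt0 : (0 < k)%N.
Proof. by rewrite divn_gt0 // dvdn_leq. Qed.

Let sub_roots : K \subset [set x | x ^+ k == 1].
Proof.
apply/subsetP => _ /imsetP[a + ->]; rewrite !inE => a0.
by rewrite -exprM mulnC divnK // expf_card_pred.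
Qed.

(** The [l]-th power map sends the [#|F|.-1] units onto [K] with fibres of size at most [l]. *)
Let card_ge : (k <= #|K|)%N.
Proof.
rewrite -(leq_pmul2r l_gt0) divnK // -card_nonzero -sum1_card.
rewrite (partition_big_imset (fun y : F => y ^+ l)) /= -sum_nat_const.
apply: leq_sum => x _; rewrite sum1_card.
apply: leq_trans (card_expf_eq_le x l_gt0).
by apply/subset_leq_card/subsetP => y; rewrite unfold_in => /andP[_ yx]; rewrite inE.
Qed.

Lemma card_lth_powers : #|K| = k.
Proof.
apply/eqP; rewrite eqn_leq card_ge andbT.
exact: leq_trans (subset_leq_card sub_roots) (card_expf_eq_le 1 k_gt0).
Qed.

(** [K] consists of roots of ['X^k - 1], and already has as many elements as that polynomial can
    have roots. *)
Lemma mem_lth_powers x : (x \in K) = (x ^+ k == 1).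
Proof.
have /eqP-> : K == [set x | x ^+ k == 1].
  by rewrite eqEcard sub_roots card_lth_powers card_expf_eq_le.
by rewrite inE.
Qed.

End PowersOfDivisor.
End FiniteField.

(** * Prime multipliers equal to 3 modulo 4 *)

Lemma mulrn_1mod (R : nzRingType) p n (x : R) :
  p \in [pchar R] -> (n = 1 %[mod p])%N -> x *+ n = x.
Proof.
by move=> pR e; rewrite -mulr_natr -(GRing.natr_mod_pchar pR) e
  (GRing.natr_mod_pchar pR) mulr1.
Qed.

Lemma exprBn_pchar_pow (R : comNzRingType) p j (x y : R) :
  p \in [pchar R] -> (x - y) ^+ (p ^ j) = x ^+ (p ^ j) - y ^+ (p ^ j).
Proof.
move=> pR; elim: j => [|j IH]; first by rewrite !expr1.
by rewrite expnSr !exprM IH -!(pFrobenius_autE pR) rmorphB.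
Qed.

Section QuadraticResidues.
Variable F : finFieldType.
Hypothesis F3 : (#|F| %% 4 = 3)%N.
Implicit Types x y z : F.
Local Notation S := (lth_powers F 2).

Lemma half_card_gt0 : (0 < #|F|.-1 %/ 2)%N.
Proof. by lia. Qed.

(** Euler's criterion: the exponent [#|F|.-1 %/ 2] is odd, so replacing [z] by [- z] flips the sign
    of the power. *)
Lemma square_or_opp_square z : z != 0 -> (z \in S) = (- z \notin S).
Proof.
move=> z0; rewrite !mem_lth_powers //; try by lia.
have /eqP := expf_card_pred z0.
rewrite (_ : #|F|.-1 = #|F|.-1 %/ 2 * 2)%N ?exprM; last by lia.
set w := z ^+ _; rewrite sqrf_eq1 mulnK // exprNn -/w.
have -> : (-1) ^+ (#|F|.-1 %/ 2) = -1 :> F by rewrite -signr_odd (_ : odd _); last by lia.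
have : 1 != -1 :> F.
  rewrite -subr_eq0 opprK -(natrD _ 1 1); apply: natf_dvd_card_neq0; lia.
by move=> n1 /orP[] /eqP->; rewrite ?mulN1r ?opprK ?eqxx 1?eq_sym (negPf n1) // eq_sym n1.
Qed.

Lemma gring_squares (R : comNzRingType) :
  gring_set R S + gring_set R [set - x | x in S] = gring_set R setT - 1.
Proof.
apply/ffunP => z; rewrite gringDE gringBE !gring_setE gring1E inE.
rewrite mem_opp_set.
have [->|z0] := eqVneq z 0; first by rewrite oppr0 (negPf (lth_powers0 _ _)) addr0 subrr.
by rewrite square_or_opp_square //; case: (- z \in S); rewrite ?addr0 ?add0r subr0.
Qed.

(** The Paley difference set. Scaling by a square and swapping the two entries of a pair are
    bijections that together carry the difference 1 to any nonzero difference. *)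
Lemma diff_pairs_squares z : z != 0 -> #|diff_pairs S z| = #|diff_pairs S 1|.
Proof.
have scale t x : t \in S -> (#|diff_pairs S x| <= #|diff_pairs S (t * x)%R|)%N.
  move=> tS; have t0 : t != 0 by apply: contraTneq tS => ->; apply: lth_powers0.
  have inj : injective (fun xy : F * F => (t * xy.1, t * xy.2)).
    by move=> [a b] [c d] [/(mulfI t0)-> /(mulfI t0)->].
  rewrite -(card_imset (mem (diff_pairs S x)) inj).
  apply/subset_leq_card/subsetP => _ /imsetP[[a b] + ->]; rewrite !inE /=.
  by case/andP=> [/andP[aS bS] /eqP<-]; rewrite !lth_powersM // mulrBr eqxx.
have scaleE t x : t \in S -> #|diff_pairs S (t * x)%R| = #|diff_pairs S x|.
  move=> tS; apply/eqP; rewrite eqn_leq scale // andbT.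
  have t0 : t != 0 by apply: contraTneq tS => ->; apply: lth_powers0.
  by rewrite -{2}[x](mulKf t0) scale ?lth_powersV.
have opp_le x : (#|diff_pairs S x| <= #|diff_pairs S (- x)%R|)%N.
  have inj : injective (fun xy : F * F => (xy.2, xy.1)) by move=> [a b] [c d] [-> ->].
  rewrite -(card_imset (mem (diff_pairs S x)) inj).
  apply/subset_leq_card/subsetP => _ /imsetP[[a b] + ->]; rewrite !inE /=.
  by case/andP=> [/andP[-> ->] /eqP<-]; rewrite opprB eqxx.
have oppE x : #|diff_pairs S (- x)%R| = #|diff_pairs S x|.
  by apply/eqP; rewrite eqn_leq opp_le -{2}[x]opprK opp_le.
move=> z0; have := square_or_opp_square z0.
case: (boolP (z \in S)) => zS; first by rewrite -{2}[z]mulr1 scaleE.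
by move/esym/negbFE => nzS; rewrite -oppE -[- z]mulr1 scaleE.
Qed.

(* The quadratic Gauss sum [tau] in the group ring: it squares to
   [setT - #|F|], and Frobenius multiplies it by the quadratic character of
   [r]; this is the usual proof of quadratic reciprocity. *)
Lemma prime_3mod4_nonsquare r :
  prime r -> (r %% 4 = 3)%N -> (r %| #|F|.-1)%N -> r%:R \notin S.
Proof.
move=> r_pr r3 r_dvd; apply/negP => rS.
have rR := pchar_Fp r_pr; have rRF := gring_pchar F rR.
pose G : gring 'F_r F := gring_set _ setT.
pose s : gring 'F_r F := gring_set _ S.
pose s' : gring 'F_r F := gring_set _ [set - x | x in S].
have l_dvd : (2 %| #|F|.-1)%N by lia.
have cardS : (#|S| * 2 = #|F|.-1)%N by rewrite card_lth_powers // divnK.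
pose b := #|diff_pairs S 1|.
have cardS2 : (#|S| = 1 + 2 * b)%N.
  have := diff_set_count diff_pairs_squares; rewrite -/b -cardS => e.
  have S_gt0 : (0 < #|S|)%N by lia.
  by apply/eqP; rewrite -(eqn_pmul2l S_gt0) mulnn e; apply/eqP; ring.
have cardF := card_1mod r_dvd.
have GG : G * G = G by rewrite gring_set_mulT cardsT (mulrn_1mod _ rRF).
have b4 : (4 * b + 3)%:R = 1 :> gring 'F_r F.
  by rewrite (_ : 4 * b + 3 = #|F|)%N; [apply: mulrn_1mod rRF _ | lia].
have ss' : s * s' = 1 *+ #|S| + (G - 1) *+ b by apply: gring_diff_set diff_pairs_squares.
have sDs' : s + s' = G - 1 by apply: gring_squares.
have tau2 : (s - s') * (s - s') = G - 1.
  have -> : (s - s') * (s - s') = (s + s') * (s + s') - 4 * (s * s') by ring.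
  rewrite sDs' ss' cardS2 natrD natrM -[_ *+ b]mulr_natr.
  have -> : (G - 1) * (G - 1) = 1 - G by rewrite mulrBl mulrBr GG; ring.
  move: b4; rewrite natrD natrM => b4.
  transitivity (1 - G - ((4 * b%:R + 3) * (G + 1) - 3 * G + 1)); first by ring.
  by rewrite b4; ring.
have tauG : (s - s') * G = 0.
  by rewrite mulrBl !gring_set_mulT card_opp_set subrr.
(* As [G] annihilates [s - s'], the factor [G - 1] acts on it as -1. *)
have tau_pow n : (s - s') * (G - 1) ^+ n = (-1) ^+ n * (s - s').
  elim: n => [|n IH]; first by rewrite !expr0 mulr1 mul1r.
  by rewrite exprSr mulrA IH -mulrA mulrBr tauG sub0r mulr1 exprSr mulrN1 mulrN mulNr.
have tau_r : (s - s') ^+ r = - (s - s').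
  rewrite [X in _ ^+ X](_ : r = (2 * r./2).+1); last by lia.
  rewrite exprS exprM expr2 tau2 tau_pow -signr_odd (_ : odd _); last by lia.
  by rewrite expr1 mulN1r.
have r0 : r%:R != 0 :> F by apply: natf_dvd_card_neq0.
have inj : injective (fun x : F => x *+ r).
  by move=> x y /=; rewrite -[x *+ r]mulr_natl -[y *+ r]mulr_natl => /(mulfI r0).
(* Here the assumption [rS] enters: multiplication by the square [r] preserves [S], so Frobenius
   fixes [s] and [s']. *)
have Sr : [set x *+ r | x in S] = S.
  apply/eqP; rewrite eqEcard (card_imset _ inj) leqnn andbT.
  by apply/subsetP => _ /imsetP[x xS ->]; rewrite -mulr_natl lth_powersM.
have S'r : [set x *+ r | x in [set - x | x in S]] = [set - x | x in S].
  rewrite -[in RHS]Sr -!imset_comp; apply: eq_imset => x /=.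
  by rewrite mulNrn.
have := exprBn_pchar_pow 1 s s' rRF.
rewrite (gring_set_Frobenius (j := 1) S rR inj).
rewrite (gring_set_Frobenius (j := 1) [set - x | x in S] rR inj).
(* Thus [s - s'] equals its opposite; its coefficient at 1 is 1, so [r] would divide 2. *)
rewrite Sr S'r tau_r => /ffunP/(_ 1)/eqP.
rewrite opprB !gringBE !gring_setE lth_powers1.
rewrite mem_opp_set.
have := square_or_opp_square (oner_neq0 F); rewrite lth_powers1 => /esym/negPf->.
rewrite sub0r subr0 eq_sym -subr_eq0 opprK -(natrD _ 1 1) -(dvdn_pcharf rR).
by move/dvdn_leq => /(_ isT); lia.
Qed.

Lemma expf_half_opp1 r : r%:R \notin S -> r%:R != 0 :> F ->
  r%:R ^+ (#|F|.-1 %/ 2) = -1 :> F.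
Proof.
move=> rS r0; have /eqP := expf_card_pred r0.
rewrite {1}(_ : #|F|.-1 = #|F|.-1 %/ 2 * 2)%N ?exprM; last by lia.
rewrite sqrf_eq1 => /orP[] /eqP // e.
by case/negP: rS; rewrite mem_lth_powers ?e //; lia.
Qed.

Section SelfConjugatePrime.
Variables (r : nat) (A : {set F}) (lambda : nat).
Hypotheses (r_pr : prime r) (r3 : (r %% 4 = 3)%N) (r_dvd : (r %| #|F|.-1)%N).
Hypothesis A_diff : forall z, z != 0 -> #|diff_pairs A z| = lambda.
Hypotheses (A1 : (#|A| = 1 %[mod r])%N) (lambda1 : (lambda = 1 %[mod r])%N).

(* Some power [N] of [r] is [-1] in [F], so raising [E := A - setT] to the
   power [N] conjugates it; as [E] times its conjugate vanishes modulo [r],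
   [E] is nilpotent, hence zero because [E ^+ (N * N) = E]. *)
Lemma diff_set_self_conjugate : A = setT.
Proof.
have rR := pchar_Fp r_pr; have rRF := gring_pchar F rR.
have cardF := card_1mod r_dvd.
pose N := (r ^ (#|F|.-1 %/ 2))%N.
pose G : gring 'F_r F := gring_set _ setT.
pose D : gring 'F_r F := gring_set _ A.
pose D' : gring 'F_r F := gring_set _ [set - x | x in A].
have N1 : N%:R = -1 :> F.
  by rewrite natrX expf_half_opp1 ?prime_3mod4_nonsquare ?natf_dvd_card_neq0.
have NE (x : F) : x *+ N = - x by rewrite -mulr_natl N1 mulN1r.
have inj : injective (fun x : F => x *+ N) by move=> x y /=; rewrite !NE => /oppr_inj.
have NS (B : {set F}) : [set x *+ N | x in B] = [set - x | x in B].
  by apply: eq_imset => x; rewrite NE.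
have G' : [set - x | x in [set: F]] = setT.
  by apply/setP => x; rewrite inE -[x]opprK imset_f.
have GG : G * G = G by rewrite gring_set_mulT cardsT (mulrn_1mod _ rRF).
have DG : D * G = G by rewrite gring_set_mulT (mulrn_1mod _ rRF).
have D'G : D' * G = G by rewrite gring_set_mulT card_opp_set (mulrn_1mod _ rRF).
have DD' : D * D' = G.
  by rewrite (gring_diff_set _ A_diff) !(mulrn_1mod _ rRF) // addrC subrK.
have EE' : (D - G) * (D' - G) = 0.
  rewrite mulrBl !mulrBr DD' DG GG [G * D']mulrC D'G; ring.
have EN : (D - G) ^+ N = D' - G.
  rewrite (exprBn_pchar_pow _ _ _ rRF) !(gring_set_Frobenius _ rR inj).
  by rewrite !NS G'.
have E'N : (D' - G) ^+ N = D - G.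
  rewrite (exprBn_pchar_pow _ _ _ rRF) !(gring_set_Frobenius _ rR inj).
  by rewrite !NS G' -imset_comp (eq_imset (g := id) _ (@opprK _)) imset_id.
have N_gt1 : (1 < N)%N.
  apply: leq_trans (prime_gt1 r_pr) _.
  by apply: (@leq_pexp2l r 1) half_card_gt0; apply: prime_gt0.
have E0 : D - G = 0.
  (* Writing [N * N] as [N.+1] plus a remainder exposes the vanishing factor
     [(D - G) * (D - G) ^+ N]. *)
  rewrite -E'N -EN -exprM -(subnKC (ltn_Pmulr N_gt1 (ltnW N_gt1))).
  by rewrite exprD exprS EN EE' mul0r.
apply/setP => x; move/ffunP/(_ x)/eqP: E0; rewrite gringBE !gring_setE !inE ffunE.
by case: (x \in A) => //; rewrite sub0r oppr_eq0 oner_eq0.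
Qed.

End SelfConjugatePrime.
End QuadraticResidues.

(** * Parity of [l] and the final divisibility argument *)

(** For odd [l], [-1 = (-1) ^+ l] lies in the group of powers, which is then symmetric. It contains
    1 but misses some unit, and doubling is injective, so [diff_set_not_symmetric] is
    contradicted. *)
Lemma lth_powers_diff_even (F : finFieldType) (l lambda : nat) :
    odd #|F| -> (1 < l)%N -> (l %| #|F|.-1)%N ->
    (forall z : F, z != 0 -> #|diff_pairs (lth_powers F l) z| = lambda) ->
  ~~ odd l.
Proof.
move=> F_odd l_gt1 l_dvd K_diff; apply/negP => l_odd.
have F_gt1 : (1 < #|F|)%N by apply/card_gt1P; exists 0, 1; rewrite // eq_sym oner_eq0.
have K_lt : (#|lth_powers F l| < #|F|.-1)%N.
  by rewrite card_lth_powers ?ltn_Pdiv //; lia.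
have /subsetPn[w] : ~~ ([set y : F | y != 0] \subset lth_powers F l).
  by apply: contraTN K_lt => /subset_leq_card; rewrite card_nonzero -leqNgt.
rewrite inE => w0 wK.
have inj2 : injective (fun x : F => x *+ 2).
  have two0 : 2%:R != 0 :> F by apply: natf_dvd_card_neq0; lia.
  by move=> x y /=; rewrite -[x *+ 2]mulr_natl -[y *+ 2]mulr_natl => /(mulfI two0).
have := diff_set_not_symmetric inj2 K_diff (lth_powers1 F l) (oner_neq0 _) wK w0.
have N1K : -1 \in lth_powers F l.
  by apply/imsetP; exists (-1); rewrite ?inE ?oppr_eq0 ?oner_eq0 // -signr_odd l_odd.
rewrite eqEcard card_opp_set leqnn andbT => /subsetPn[_ /imsetP[x xK ->]].
by rewrite -mulN1r lth_powersM.
Qed.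

Theorem theorem2 (p m q l : nat) (F : finFieldType)
  (p_prime : prime p) (p_odd : odd p) (m_gt0 : (0 < m)%N)
  (qE : q = (p ^ m)%N) (cardF : #|F| = q)
  (l_ge2 : (2 <= l)%N) (l_dvd : (l %| q - 1)%N)
  (K_diff : difference_set (lth_powers F l))
  (qk_square : perfect_square (q - #|lth_powers F l|)) :
  (4 %| l)%N \/
  exists a b : int,
    [/\ ~~ (2 %| a)%Z, ~~ (2 %| b)%Z & l%:Z = a ^+ 2 + b ^+ 2].
Proof.
have F_odd : odd #|F| by rewrite cardF qE oddX p_odd orbT.
have F_gt1 : (1 < #|F|)%N by apply/card_gt1P; exists 0, 1; rewrite // eq_sym oner_eq0.
move: l_dvd qk_square; rewrite -cardF subn1 => l_dvd [s sE].
have l_gt0 : (0 < l)%N by exact: ltnW.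
have {K_diff} [lambda _ K_diff] := K_diff.
change (forall z : F, z != 0 -> #|diff_pairs (lth_powers F l) z| = lambda) in K_diff.
have l_even := lth_powers_diff_even F_odd l_ge2 l_dvd K_diff.
case: (boolP (4 %| l)%N) => [|l_n4]; [by left | right].
set k := #|lth_powers F l| in sE.
have klE : (k * l = #|F|.-1)%N by rewrite /k card_lth_powers // divnK.
have k_gt0 : (0 < k)%N by rewrite /k; apply/card_gt0P; exists 1; apply: lth_powers1.
have kE : (k = lambda * l + 1)%N.
  have := diff_set_count K_diff; rewrite -/k -klE => e.
  by apply/eqP; rewrite -(eqn_pmul2l k_gt0) mulnn e; apply/eqP; ring.
have FE : (#|F| = k * l + 1)%N by rewrite klE addn1 prednK // ltnW.
(* [#|F| = lambda * l ^ 2 + l + 1], where [l] is 2 modulo 4. *)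
have F3 : (#|F| %% 4 = 3)%N.
  have [c lE] : exists c, (l = 4 * c + 2)%N by exists (l %/ 4)%N; lia.
  rewrite FE kE lE.
  rewrite (_ : _ + 1 = (lambda * (4 * c * c + 4 * c + 1) + c) * 4 + 3)%N ?modnMDl //.
  by ring.
have sqE : (s ^ 2 = l * (1 + lambda * l.-1))%N.
  have lE := prednK l_gt0.
  rewrite -sE FE (_ : _ + 1 = l * (1 + lambda * l.-1) + k)%N ?addnK //.
  by rewrite kE -lE /=; ring.
have twosq : sum_two_squares l.
  apply: sum_two_squaresP => // r r_pr r3; apply/negP => r_odd.
  have r_dvd_l : (r %| l)%N.
    by move: r_odd; rewrite -(expn1 r) pfactor_dvdn //; case: logn.
  (* The exponent of [r] in the square [l * (1 + lambda * l.-1)] is even and its exponent in [l] is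
     odd, so the other factor contributes an odd, hence positive, exponent. *)
  have r_dvd_n : (r %| 1 + lambda * l.-1)%N.
    rewrite -(expn1 r) pfactor_dvdn //.
    have := congr1 (logn r) sqE; rewrite lognX lognM // => e.
    by have : odd (logn r l) := r_odd; lia.
  (* Modulo [r], [l.-1] is -1, so [1 + lambda * l.-1] is [1 - lambda]. *)
  have lambda1 : (lambda = 1 %[mod r])%N.
    have -> : (1 = 1 + lambda * l.-1 - lambda * l.-1)%N by rewrite addnK.
    have [c cE] := dvdnP r_dvd_l; have [d dE] := dvdnP r_dvd_n.
    rewrite addnK -(modnMDl d lambda) -dE -(modnMDl (lambda * c) 1) -mulnA -cE.
    by congr modn; rewrite -{2}(prednK l_gt0); ring.
  have A1 : (k = 1 %[mod r])%N.
    by rewrite kE -modnDml -modnMmr (eqP r_dvd_l) muln0 mod0n.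
  have := diff_set_self_conjugate F3 r_pr r3 (dvdn_trans r_dvd_l l_dvd) K_diff A1 lambda1.
  by move/setP/(_ 0); rewrite inE (negPf (lth_powers0 _ _)).
have [a [b lE]] := twosq; exists a, b.
(* Squares are 0 or 1 modulo 4, so a sum of two squares that is 2 modulo 4 has both terms odd. *)
have [c lc] : exists c, (l = 4 * c + 2)%N by exists (l %/ 4)%N; lia.
have sq_even (x : int) : (2 %| x)%Z -> exists y, x ^+ 2 = 4 * y.
  by case/dvdzP => y ->; exists (y ^+ 2); ring.
have sq_odd (x : int) : ~~ (2 %| x)%Z -> exists y, x ^+ 2 = 4 * y + 1.
  move=> hx; have -> : x = 2 * (x %/ 2)%Z + 1 by lia.
  by exists ((x %/ 2)%Z ^+ 2 + (x %/ 2)%Z); ring.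
split=> //.
  apply/negP => /sq_even[y ay].
  case: (boolP (2 %| b)%Z) => [/sq_even|/sq_odd] [y' by']; lia.
apply/negP => /sq_even[y by'].
case: (boolP (2 %| a)%Z) => [/sq_even|/sq_odd] [y' ay]; lia.
Qed.
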